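(* Let $Y$ be a real vector space. Each compatible partial preference $\prec\,\subset Y\times Y$ can be regularly extended to a compatible weak preference $\prec'\,\subset Y\times Y$; that is, there exists a compatible weak preference $\prec'$ on $Y$ which regularly extends $\prec$.
   Context: A partial preference on $Y$ is an asymmetric and transitive binary relation $\prec$. The indifference relation generated by $\prec$ is: $y\asymp z$ iff neither $y\prec z$ nor $z\prec y$. The equipotency relation generated by $\prec$ is: $y_1\sim y_2$ iff $\{y\in Y\mid y\asymp y_1\}=\{y\in Y\mid y\asymp y_2\}$. A partial preference is a weak preference if $\asymp$ is transitive. A binary relation $\prec$ on $Y$ is compatible if $y_1\prec y_2$ implies $\lambda y_1\prec\lambda y_2$ and $y_1+y\prec y_2+y$ for all $y\in Y$ and all real $\lambda>0$. A partial preference $\prec_1$ regularly extends a partial preference $\prec_2$ if $\prec_2\,\subseteq\,\prec_1$ and $\sim_2\,\subseteq\,\sim_1$, where $\sim_i$ is the equipotency relation generated by $\prec_i$. *)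

(* Defs.v *)
From mathcomp Require Import all_boot all_order all_algebra.
From mathcomp Require Import boolp classical_sets reals.
From Stdlib Require Import RelationClasses.

Set Implicit Arguments.
Unset Strict Implicit.
Unset Printing Implicit Defensive.

Import Order.TTheory GRing.Theory Num.Theory.

Local Open Scope classical_set_scope.
Local Open Scope ring_scope.

Definition partial_preference (Y : Type) (prec : Y -> Y -> Prop) : Prop :=
  Asymmetric prec /\ Transitive prec.

Definition indifferent (Y : Type) (prec : Y -> Y -> Prop) (y z : Y) : Prop :=
  ~ prec y z /\ ~ prec z y.

Definition equipotent (Y : Type) (prec : Y -> Y -> Prop) (y1 y2 : Y) : Prop :=
  [set y | indifferent prec y y1] = [set y | indifferent prec y y2].

Definition weak_preference (Y : Type) (prec : Y -> Y -> Prop) : Prop :=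
  partial_preference prec /\ Transitive (indifferent prec).

Definition compatible (R : realType) (Y : lmodType R)
    (prec : Y -> Y -> Prop) : Prop :=
  forall y1 y2 : Y, prec y1 y2 ->
    (forall lambda : R, 0 < lambda -> prec (lambda *: y1) (lambda *: y2)) /\
    (forall y : Y, prec (y1 + y) (y2 + y)).

Definition regularly_extends (Y : Type) (prec1 prec2 : Y -> Y -> Prop) : Prop :=
  subrelation prec2 prec1 /\ subrelation (equipotent prec2) (equipotent prec1).

(* Main.v *)
Require Import Defs.
From mathcomp Require Import all_boot all_order all_algebra.
From mathcomp Require Import boolp classical_sets reals.

(** A compatible partial preference is [y - x \in P] for a convex cone [P]
  without [0].  The elements equipotent to [0] form a linear subspace [L], and
  [P + L = P].  By Zorn's lemma there is a maximal convex cone [C] without [0]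
  such that [P] is included in [C] and [C + L = C]; if [x] were in none of [C],
  [-C] and [L], then adjoining to [C] all [d + t x] with [t > 0] and [d] in
  [C] or [L] would enlarge it.  So the indifference relation of the preference
  given by [C] is congruence modulo [L], which is transitive. *)

Set Implicit Arguments.
Unset Strict Implicit.
Unset Printing Implicit Defensive.

Import Order.TTheory GRing.Theory Num.Theory.

Local Open Scope classical_set_scope.
Local Open Scope ring_scope.

(** Zorn is applied to the sets [X] with [A]|[X] in [P]. The empty chain then yields [A] itself, and
    the union of a nonempty chain becomes a union of sets [A]|[X]. *)
Lemma Zorn_bigcup_above (T : Type) (P : set (set T)) (A : set T) :
    P A ->
    (forall F : set (set T), F !=set0 -> F `<=` P -> total_on F subset ->
      P (\bigcup_(X in F) X)) ->
  exists M, [/\ P M, A `<=` M & forall B, P B -> M `<=` B -> B `<=` M].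
Proof.
move=> PA Pchain.
have [F FP Ftot|M [PM Mmax]] := @Zorn_bigcup T (fun X => P (A `|` X)).
  have [->|/set0P F0] := eqVneq F set0; first by rewrite bigcup_set0 setU0.
  have -> : A `|` \bigcup_(X in F) X =
      \bigcup_(X in [set A `|` X | X in F]) X.
    apply/seteqP; split=> [x [Ax|[X FX Xx]]|x [_ [X FX <-] [Ax|Xx]]].
    - by have [X FX] := F0; exists (A `|` X); [exists X | left].
    - by exists (A `|` X); [exists X | right].
    - by left.
    - by right; exists X.
  apply: Pchain => [|_ [X FX <-]|_ _ [X FX <-] [Z FZ <-]]; last 1 first.
  - by have [XZ|ZX] := Ftot _ _ FX FZ; [left|right]; exact: setUS.
  - by have [X FX] := F0; exists (A `|` X); exists X.
  - exact: FP.
exists (A `|` M); split=> // B PB AMB.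
apply: contrapT => nBAM.
have AB : A `<=` B by move=> x Ax; apply: AMB; left.
apply: (Mmax B); last by rewrite setUidr.
split; first by move=> x Mx; apply: AMB; right.
by move=> BM; apply: nBAM => x /BM; right.
Qed.

Section Cones.
Variables (R : realType) (Y : lmodType R).
Implicit Types C L : set Y.

Definition convex_cone C :=
  (forall x y, C x -> C y -> C (x + y)) /\
  (forall (t : R) x, 0 < t -> C x -> C (t *: x)).

Definition subspace L :=
  [/\ L 0, forall x y, L x -> L y -> L (x + y)
    & forall (t : R) x, L x -> L (t *: x)].

(** The last condition lets [C] be read as a cone in the quotient of [Y] by [L]. *)
Definition strict_cone_mod L C :=
  [/\ ~ C 0, convex_cone C & forall x h, C x -> L h -> C (x + h)].

Lemma strict_cone_mod_bigcup L (F : set (set Y)) :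
    F `<=` strict_cone_mod L -> total_on F subset ->
  strict_cone_mod L (\bigcup_(X in F) X).
Proof.
move=> FP Ftot; split.
- by move=> [X /FP[]].
- split=> [x y [X FX Xx] [Z FZ Zy]|t x t0 [X FX Xx]].
  + have [XZ|ZX] := Ftot _ _ FX FZ.
      by exists Z => //; have [_ [ZD _] _] := FP _ FZ; apply: ZD => //; exact: XZ.
    by exists X => //; have [_ [XD _] _] := FP _ FX; apply: XD => //; exact: ZX.
  + by exists X => //; have [_ [_ XZ] _] := FP _ FX; exact: XZ.
- by move=> x h [X FX Xx] Lh; exists X => //; have [_ _] := FP _ FX; exact.
Qed.

(** Remainders in [L] are allowed so that [x] itself belongs to the set. The coefficient 0 is paired
    with [C] alone, since pairing it with [L] would let 0 in. *)
Definition adjoin C L (x : Y) : set Y :=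
  [set z | C z \/ exists2 t : R, 0 < t & (C `|` L) (z - t *: x)].

(** If 0 were in the new set, [- (t *: x)] would lie in [C] or in [L], and rescaling would put [- x]
    in [C] or [x] in [L]. The closure laws hold because [C]|[L] is stable under sums and positive
    scaling, and a sum with a term in [C] stays in [C]. *)
Lemma strict_cone_mod_adjoin L C (x : Y) :
    subspace L -> strict_cone_mod L C -> ~ C (- x) -> ~ L x ->
  strict_cone_mod L (adjoin C L x).
Proof.
move=> [L0 LD LZ] [C0 [CD CZ] CL] nCx nLx.
have CU a b : C a -> (C `|` L) b -> C (a + b).
  by move=> Ca [Cb|Lb]; [exact: CD|exact: CL].
have UU a b : (C `|` L) a -> (C `|` L) b -> (C `|` L) (a + b).
  by move=> [Ca|La] [Cb|Lb]; [left; exact: CD | left; exact: CL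
    | left; rewrite addrC; exact: CL | right; exact: LD].
have UZ t a : 0 < t -> (C `|` L) a -> (C `|` L) (t *: a).
  by move=> t0 [Ca|La]; [left; exact: CZ | right; exact: LZ].
split.
- move=> [//|[t t0]]; rewrite sub0r => -[Ctx|Ltx].
    apply: nCx; have := CZ t^-1 _ (_ : 0 < t^-1) Ctx.
    by rewrite invr_gt0 scalerN scalerA mulVf ?gt_eqF// scale1r; exact.
  apply: nLx; have := LZ (- t^-1) _ Ltx.
  by rewrite scalerN scaleNr opprK scalerA mulVf ?gt_eqF// scale1r.
- split=> [a b [Ca|[s s0 Ua]] [Cb|[t t0 Ub]]|t a t0 [Ca|[s s0 Ua]]].
  + by left; exact: CD.
  + by right; exists t => //; left; rewrite -addrA; exact: CU.
  + right; exists s => //; left; rewrite addrAC addrC; exact: CU.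
  + right; exists (s + t); first exact: addr_gt0.
    by rewrite scalerDl opprD addrACA; exact: UU.
  + by left; exact: CZ.
  + right; exists (t * s); first exact: mulr_gt0.
    by rewrite -scalerA -scalerBr; exact: UZ.
- move=> a h [Ca|[t t0 Ua]] Lh; first by left; exact: CL.
  by right; exists t => //; rewrite addrAC; apply: UU => //; right.
Qed.

Lemma strict_cone_mod_total L C :
    subspace L -> strict_cone_mod L C ->
  exists C', [/\ strict_cone_mod L C', C `<=` C'
    & forall x, [\/ C' x, C' (- x) | L x]].
Proof.
move=> Lsub CP.
have [F _ FP Ftot|M [MP CM Mmax]] := @Zorn_bigcup_above _ (strict_cone_mod L) C CP.
  exact: strict_cone_mod_bigcup.
exists M; split=> // x.
have [CNx|nCNx] := pselect (M (- x)); first by apply: Or32.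
have [Lx|nLx] := pselect (L x); first by apply: Or33.
apply: Or31; apply: (Mmax (adjoin M L x)).
- exact: strict_cone_mod_adjoin.
- by move=> z Mz; left.
(* [x] is obtained with coefficient 1 and remainder 0, which lies in [L]. *)
- right; exists 1; first exact: ltr01.
  by rewrite scale1r subrr; right; have [] := Lsub.
Qed.

Lemma strict_cone_mod_disjoint L C x :
  subspace L -> strict_cone_mod L C -> C x -> ~ L x.
Proof.
move=> [_ _ LZ] [C0 _ CL] Cx Lx; apply: C0.
by rewrite -(subrr x) -scaleN1r; apply: CL => //; exact: LZ.
Qed.

Lemma subspaceN L x : subspace L -> L x -> L (- x).
Proof. by move=> [_ _ LZ] Lx; rewrite -scaleN1r; exact: LZ. Qed.

Definition cone_pref C (x y : Y) : Prop := C (y - x).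

Lemma cone_pref_partial L C :
  strict_cone_mod L C -> partial_preference (cone_pref C).
Proof.
move=> [C0 [CD _] _]; split=> [x y Cxy Cyx|x y z Cxy Cyz].
  by apply: C0; have := CD _ _ Cxy Cyx; rewrite addrA subrK subrr.
by have := CD _ _ Cyz Cxy; rewrite addrA subrK.
Qed.

Lemma cone_pref_compatible C : convex_cone C -> compatible (cone_pref C).
Proof.
move=> [_ CZ] x y Cxy; split=> [t t0|z]; rewrite /cone_pref.
  by rewrite -scalerBr; exact: CZ.
by rewrite opprD addrACA subrr addr0.
Qed.

(** Indifference says that [y - x] is in neither [C] nor [- C], so the trichotomy leaves only [L].
    Conversely, [L] is symmetric and disjoint from [C]. *)
Lemma cone_pref_indifferent L C x y :
    subspace L -> strict_cone_mod L C ->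
    (forall z, [\/ C z, C (- z) | L z]) ->
  indifferent (cone_pref C) x y <-> L (y - x).
Proof.
move=> Lsub CP Ctot; split=> [[nCxy nCyx]|Lxy].
  by have [//|Cyx|//] := Ctot (y - x); move: Cyx; rewrite opprB.
split=> Cxy; apply: (strict_cone_mod_disjoint Lsub CP Cxy) => //.
by rewrite -opprB; exact: subspaceN.
Qed.

End Cones.

(** As [x] is not indifferent to [y], it is not indifferent to [z], so the two are comparable. The
    case [prec z x] would give [prec z y], whereas [y], being indifferent to itself, is indifferent
    to [z]. *)
Lemma prec_equipotent (Y : Type) (prec : Y -> Y -> Prop) x y z :
  partial_preference prec -> prec x y -> equipotent prec y z -> prec x z.
Proof.
move=> [pasym ptrans] xy yz.
have yIz u : indifferent prec u y = indifferent prec u z.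
  by have := congr1 (@^~ u) yz.
have nyy : ~ prec y y by move=> yy; exact: (pasym _ _ yy yy).
have : ~ indifferent prec x z by rewrite -yIz => -[].
have : indifferent prec y z by rewrite -yIz.
move=> [_ nzy] nxz; apply: contrapT => nxz'; apply: nxz; split=> // zx.
exact/nzy/(ptrans _ _ _ zx xy).
Qed.

Section Compatible.
Variables (R : realType) (Y : lmodType R) (prec : Y -> Y -> Prop).
Hypothesis hcomp : compatible prec.

Lemma precD2r z x y : prec (x + z) (y + z) <-> prec x y.
Proof.
split=> [/hcomp[_ /(_ (- z))]|/hcomp[_]]; last exact.
by rewrite !addrK.
Qed.

Lemma precZ (t : R) x y : 0 < t -> prec (t *: x) (t *: y) <-> prec x y.
Proof.
move=> t0; split=> [/hcomp[/(_ t^-1)]|/hcomp[+ _]]; last exact.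
by rewrite invr_gt0 !scalerA mulVf ?gt_eqF// !scale1r => + _; exact.
Qed.

Lemma equipotentD z x y : equipotent prec x y -> equipotent prec (x + z) (y + z).
Proof.
move=> xy; apply/seteqP.
have xIy u : indifferent prec u x = indifferent prec u y.
  by have := congr1 (@^~ u) xy.
have E u v : indifferent prec u (v + z) <-> indifferent prec (u - z) v.
  by rewrite /indifferent -(precD2r z (u - z)) -(precD2r z v) subrK.
by split=> u /= /E; [rewrite xIy | rewrite -xIy] => /E.
Qed.

Lemma equipotentZ (t : R) x y :
  0 < t -> equipotent prec x y -> equipotent prec (t *: x) (t *: y).
Proof.
move=> t0 xy; apply/seteqP.
have xIy u : indifferent prec u x = indifferent prec u y.
  by have := congr1 (@^~ u) xy.
have E u v : indifferent prec u (t *: v) <-> indifferent prec (t^-1 *: u) v.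
  rewrite /indifferent -(precZ (t^-1 *: u) _ t0) -(precZ v _ t0).
  by rewrite scalerA mulfV ?gt_eqF// scale1r.
by split=> u /= /E; [rewrite xIy | rewrite -xIy] => /E.
Qed.

Lemma equipotent0_subspace : subspace [set h | equipotent prec h 0].
Proof.
have D h k : equipotent prec h 0 -> equipotent prec k 0 ->
    equipotent prec (h + k) 0.
  by move=> /(equipotentD k) hk k0; apply: etrans hk _; rewrite add0r.
(* Compatibility covers positive scalars only; the sign change comes from translating by [- h]. *)
have N h : equipotent prec h 0 -> equipotent prec (- h) 0.
  by move=> /(equipotentD (- h)); rewrite subrr add0r => /esym.
have Z t h : 0 < t -> equipotent prec h 0 -> equipotent prec (t *: h) 0.
  by move=> t0 /(equipotentZ t0); rewrite scaler0.
split=> //= t h h0.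
have [t0|t0|->] := ltgtP t 0; last by rewrite scale0r.
- by rewrite -[t]opprK scaleNr; apply/N/Z; rewrite ?oppr_gt0.
- exact: Z.
Qed.

Lemma prec_cone : partial_preference prec ->
  strict_cone_mod [set h | equipotent prec h 0] [set y | prec 0 y].
Proof.
move=> pp; have [pasym ptrans] := pp.
have D x y : prec 0 y -> prec x (y + x).
  by move=> /(precD2r x); rewrite add0r.
split=> /=; first by move=> p00; exact: (pasym _ _ p00 p00).
  split=> /= [x y x0 y0|t x t0 /(precZ _ _ t0)].
    by rewrite addrC; exact: (ptrans _ _ _ x0 (D _ _ y0)).
  by rewrite scaler0.
(* Translating by [x] makes [x] equipotent to [x + h], so [x + h] inherits [prec 0 x]. *)
move=> x h x0 /esym/(equipotentD x); rewrite add0r addrC.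
exact: prec_equipotent.
Qed.

End Compatible.

Theorem theorem6p3 (R : realType) (Y : lmodType R) (prec : Y -> Y -> Prop)
    (hprec : partial_preference prec) (hcomp : compatible prec) :
  exists prec' : Y -> Y -> Prop,
    weak_preference prec' /\ compatible prec' /\ regularly_extends prec' prec.
Proof.
have Lsub := equipotent0_subspace hcomp.
have [C [CP precC Ctot]] := strict_cone_mod_total Lsub (prec_cone hcomp hprec).
have IE x y := @cone_pref_indifferent _ _ _ _ x y Lsub CP Ctot.
have [_ LD _] := Lsub.
have [_ Ccone _] := CP.
exists (cone_pref C); split; last split; last split.
- split; first exact: cone_pref_partial CP.
  move=> x y z /IE Lxy /IE Lyz; apply/IE.
  by have := LD _ _ Lyz Lxy; rewrite addrA subrK.
- exact: cone_pref_compatible.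
- move=> x y xy; apply: precC => /=.
  by rewrite -(precD2r hcomp x) add0r subrK.
(* Equipotence of [x] and [y] puts [x - y] in the subspace. The indifference classes of the new
   preference are its cosets, so those of [x] and [y] coincide. *)
- move=> x y /(equipotentD hcomp (- y)); rewrite subrr => Lxy.
  apply/seteqP; split=> z /= /IE Lz; apply/IE.
    have := LD _ _ (subspaceN Lsub Lxy) Lz.
    by rewrite opprB addrA subrK.
  by have := LD _ _ Lxy Lz; rewrite addrA subrK.
Qed.
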